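(* Assume that $\omega_1<\mathfrak b=\mathfrak d$. Then there is a $\mathfrak b$-concentrated Hurewicz set of reals $Y$ such that for each countable set $D\subseteq Y$ such that $Y$ is $\mathfrak b$-concentrated on $D$, and for each countable set $D'\subseteq Y$ such that $D\subseteq D'$, there is a countable set $A\subseteq Y\setminus D'$ such that $Y\setminus A$ is not Hurewicz.
   Context: A set of reals is an infinite topological space homeomorphic to a subspace of the Cantor cube $2^\omega$. For $a,b\in\omega^\omega$, $a\le^* b$ means $a(n)\le b(n)$ for all but finitely many $n$; $\mathfrak b$ is the minimal cardinality of a subset of $\omega^\omega$ that has no $\le^*$-upper bound in $\omega^\omega$, and $\mathfrak d$ is the minimal cardinality of a subset $A\subseteq\omega^\omega$ such that for each $x\in\omega^\omega$ there is $a\in A$ with $x\le^* a$. A space $X$ is Hurewicz if for each sequence $\mathcal U_0,\mathcal U_1,\dots$ of open covers of $X$ there are finite sets $\mathcal F_n\subseteq\mathcal U_n$ such that for each $x\in X$ the set $\{n: x\in\bigcup\mathcal F_n\}$ is cofinite. For an infinite cardinal $\kappa$, a set of reals $Y$ is $\kappa$-concentrated on a set $D\subseteq Y$ if $|Y|\ge\kappa$ and $|Y\setminus U|<\kappa$ for each open set $U$ containing $D$. It is $\kappa$-concentrated if it is $\kappa$-concentrated on some countable subset of $Y$. *)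

(* Defs.v *)
From mathcomp Require Import all_boot.
From mathcomp Require Import all_classical topology cantor.
Set Implicit Arguments.
Unset Strict Implicit.
Unset Printing Implicit Defensive.

Local Open Scope classical_set_scope.
Local Open Scope card_scope.

(* The library has no type of cardinals: a cardinal is represented by a set of
   that cardinality, and cardinals are compared with [#<=], [#=] and [#<]. *)

Definition card_lt T U (A : set T) (B : set U) : Prop :=
  (A #<= B) /\ ~ (B #<= A).
Notation "A '#<' B" := (card_lt A B) (at level 79) : card_scope.

(* Zorn's lemma applied to the sets of choice functions with injective
   coordinates. *)
Lemma least_card_family I T (A : I -> set T) (i0 : I) :
  exists i, forall j, A i #<= A j.
Proof.
pose P (S : set (I -> T)) := (forall s i, S s -> A i (s i)) /\
  (forall i s t, S s -> S t -> s i = t i -> s = t).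
have [|S [[Sfun Sinj] Smax]] := @Zorn_bigcup _ P.
  move=> F FP Ftot; split=> [s i [X FX Xs]|i s t [X FX Xs] [Y FY Yt] st].
    exact: (FP _ FX).1.
  have [XY|YX] := Ftot _ _ FX FY.
    by apply: (FP _ FY).2 st => //; exact: XY.
  by apply: (FP _ FX).2 st => //; exact: YX.
have [i Ai] : exists i, A i `<=` (fun s => s i) @` S.
  apply: contrapT => noi.
  have /choice[f fP] : forall i, exists x, A i x /\ forall s, S s -> s i <> x.
    move=> i; apply: contrapT => nox; apply: noi; exists i => x Aix.
    apply: contrapT => nSx; apply: nox; exists x; split=> // s Ss six.
    by apply: nSx; exists s.
  apply: (Smax (S `|` [set f])).
    split=> [s Ss|sub]; first by left.
    have Sf : S f by apply: sub; right.
    exact: (fP i0).2 Sf erefl.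
  split=> [s i [Ss|->]|i s t [Ss|->] [St|->]//].
  - exact: Sfun.
  - exact: (fP i).1.
  - exact: Sinj.
  - by move=> /((fP i).2 _ Ss).
  - by move=> /esym/((fP i).2 _ St).
exists i => j; apply: card_le_trans (subset_card_le Ai) _.
apply: card_le_trans (card_image_le _ _) _.
have : (fun s : I -> T => s j) @` S #= S.
  by apply: inj_card_eq => s t /set_mem Ss /set_mem St; exact: Sinj.
rewrite card_eq_le => /andP[_ SA].
apply: card_le_trans SA (subset_card_le _) => _ [s Ss <-].
exact: Sfun.
Qed.

Definition of_least_card T (P : set T -> Prop) (B : set T) : Prop :=
  P B /\ forall A, P A -> B #<= A.

Lemma of_least_card_ex T (P : set T -> Prop) (A0 : set T) :
  P A0 -> exists B, of_least_card P B.
Proof.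
move=> PA0; have [[B PB] Bmin] :=
  @least_card_family {A : set T | P A} T sval (exist _ _ PA0).
by exists B; split=> // A PA; exact: (Bmin (exist _ A PA)).
Qed.

Definition eventually_le (a b : nat -> nat) : Prop :=
  cofinite_set [set n | (a n <= b n)%N].

Definition unbounded_family (F : set (nat -> nat)) : Prop :=
  ~ exists c, forall a, F a -> eventually_le a c.

Definition dominating_family (F : set (nat -> nat)) : Prop :=
  forall x, exists2 a, F a & eventually_le x a.

Lemma bounding_number_ex : exists B, of_least_card unbounded_family B.
Proof.
apply: (@of_least_card_ex _ _ setT) => -[c /(_ (fun n => (c n).+1) I)].
rewrite /eventually_le (_ : [set _ | _] = set0) ?setC0; last first.
  by apply/seteqP; split=> n //=; rewrite ltnn.
exact: infinite_nat.
Qed.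

Lemma dominating_number_ex : exists B, of_least_card dominating_family B.
Proof.
apply: (@of_least_card_ex _ _ setT) => x; exists x => //.
rewrite /eventually_le (_ : [set _ | _] = setT) ?setCT//.
by apply/seteqP; split=> n //=; rewrite leqnn.
Qed.

Lemma omega1_ex : exists W : set (nat -> nat), ~ countable W /\
  forall T (A : set T), ~ countable A -> W #<= A.
Proof.
have [|W [Wunc Wmin]] :=
    @of_least_card_ex (nat -> nat) (fun A => ~ countable A) setT.
  move=> /pcard_injP[f finj]; pose g n := (get [set x | f x = n] n).+1.
  have /(congr1 (fun h => h (f g))) : get [set x | f x = f g] = g.
    apply: finj; rewrite ?inE//.
    exact: (@getI _ [set x | f x = f g] g).
  by rewrite {2}/g => /esym/eqP; rewrite gtn_eqF.
exists W; split=> // T A Aunc.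
pose F (b : bool) : set ((nat -> nat) + T) := if b then inl @` W else inr @` A.
have FW : (inl : _ -> (nat -> nat) + T) @` W #= W.
  by apply: inj_card_eq => x y _ _ [].
have FA : (inr : _ -> (nat -> nat) + T) @` A #= A.
  by apply: inj_card_eq => x y _ _ [].
have [[] Fmin] := least_card_family F true.
  by have := Fmin false; rewrite /F (card_le_eql FW) (card_le_eqr FA).
have := Fmin true; rewrite /F (card_le_eql FA) (card_le_eqr FW).
move=> /pcard_leP[f].
have fA : f @` A #= A by apply: inj_card_eq; exact: 'inj_f.
rewrite -(card_le_eqr fA); apply: Wmin.
by rewrite (eq_countable fA).
Qed.

Definition bounding_number : set (nat -> nat) := sval (cid bounding_number_ex).

Definition dominating_number : set (nat -> nat) :=
  sval (cid dominating_number_ex).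

Definition omega1 : set (nat -> nat) := sval (cid omega1_ex).

Lemma bounding_numberP : of_least_card unbounded_family bounding_number.
Proof. exact: svalP (cid bounding_number_ex). Qed.

Lemma dominating_numberP : of_least_card dominating_family dominating_number.
Proof. exact: svalP (cid dominating_number_ex). Qed.

Lemma omega1P : ~ countable omega1 /\
  forall T (A : set T), ~ countable A -> omega1 #<= A.
Proof. exact: svalP (cid omega1_ex). Qed.

Definition homeomorphic (X Y : topologicalType) : Prop :=
  exists (f : X -> Y) (g : Y -> X),
    [/\ cancel f g, cancel g f, continuous f & continuous g].

(* [set_type Z] carries the subspace topology induced by [Z]. *)
Definition set_of_reals (X : topologicalType) : Prop :=
  infinite_set [set: X] /\
  exists Z : set cantor_space, homeomorphic X (set_type Z).

Definition open_cover (X : topologicalType) (U : set (set X)) : Prop :=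
  U `<=` open /\ \bigcup_(V in U) V = [set: X].

Definition Hurewicz (X : topologicalType) : Prop :=
  forall U : nat -> set (set X), (forall n, open_cover (U n)) ->
  exists F : nat -> set (set X),
    (forall n, F n `<=` U n /\ finite_set (F n)) /\
    forall x : X, cofinite_set [set n | (\bigcup_(V in F n) V) x].

Definition concentrated_on T (K : set T) (Y : topologicalType) (D : set Y) :
    Prop :=
  (K #<= [set: Y]) /\
  forall U : set Y, open U -> D `<=` U -> [set: Y] `\` U #< K.

Definition concentrated T (K : set T) (Y : topologicalType) : Prop :=
  exists D : set Y, countable D /\ concentrated_on K D.

(* Main.v *)
Require Import Defs.
From mathcomp Require Import all_boot.
From mathcomp Require Import all_classical topology cantor.
From mathcomp Require Import wochoice zify.

(* Since b = d there is a scale S, a dominating family such that every g is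
   eventually dominated by all but fewer than b members of S.  Take an
   uncountable T of size omega_1 in the Cantor space, and for s in S and t in T
   let [blend s t] agree alternately with t and with the zero sequence 0 on
   consecutive intervals growing faster than s.  The space Y consists of the
   sequences that are eventually equal to 0 or to some t in T, and of all the
   blends.
   Most blends contain long intervals of 0, so that Y is b-concentrated on the
   countable set of sequences eventually equal to 0.
   For a fixed t, any finite selection rate that covers the sequences
   eventually equal to 0 or t also covers most blends with t: an interval
   starting at n meets at most a change of pattern after which the new pattern
   lasts long enough.  Since |T| < b, the bounds for all t have a common bound,
   and Y is Hurewicz.
   Removing the class of t destroys this: on what remains, the next position
   after n where y differs from t is a continuous function of y, and it is
   unbounded on the blends with t.  A countable D' meets the class of only
   countably many t in T. *)

Set Implicit Arguments.
Unset Strict Implicit.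
Unset Printing Implicit Defensive.

Local Open Scope classical_set_scope.
Local Open Scope card_scope.

(** * Cofinite sets and comparison of cardinals *)

Lemma cofinite_natP (A : set nat) :
  cofinite_set A <-> exists N, forall n, (N <= n)%N -> A n.
Proof.
split=> [/finite_seqP[s sA] | [N AN]].
  exists (\max_(i <- s) i).+1 => n ltn; apply: contrapT => nAn.
  have : [set` s] n by rewrite -sA.
  by move=> /(@leq_bigmax_seq _ _ xpredT id)-/(_ erefl); rewrite leqNgt ltn.
apply: (@sub_finite_set _ _ `I_N); last exact: finite_II.
by move=> n /= nA; rewrite ltnNge; apply/negP => /AN.
Qed.

Lemma card_le_total T U (A : set T) (B : set U) : A #<= B \/ B #<= A.
Proof.
pose F (b : bool) : set (T + U) := if b then inl @` A else inr @` B.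
have FA : (inl : _ -> T + U) @` A #= A.
  by apply: inj_card_eq => x y _ _ [].
have FB : (inr : _ -> T + U) @` B #= B.
  by apply: inj_card_eq => x y _ _ [].
have [[] Fmin] := least_card_family F true.
  by left; have := Fmin false; rewrite /F (card_le_eql FA) (card_le_eqr FB).
by right; have := Fmin true; rewrite /F (card_le_eql FB) (card_le_eqr FA).
Qed.

Lemma eventually_le_trans b a c :
  eventually_le a b -> eventually_le b c -> eventually_le a c.
Proof.
move=> /cofinite_natP[N ab] /cofinite_natP[M bc]; apply/cofinite_natP.
exists (maxn N M) => n; rewrite geq_max => /andP[/ab ? /bc].
exact: leq_trans.
Qed.

(** * Sets with fewer than b elements *)

(* A set is small when it has fewer than b elements.  By [smallP] this is the
   same as having only bounded images in the Baire space, which spares all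
   cardinal arithmetic. *)
Definition small {T} (A : set T) := ~ (bounding_number #<= A).

Lemma smallP T (A : set T) : small A <->
  forall f : T -> nat -> nat, exists c, forall x, A x -> eventually_le (f x) c.
Proof.
have [unb minb] := bounding_numberP; split=> [sA f|bA /pcard_surjP[f fB]].
  apply: contrapT => nb; apply: sA; apply: card_le_trans (card_image_le f A).
  by apply: minb => -[c fc]; apply: nb; exists c => x Ax; apply: fc; exists x.
have [c fc] := bA f.
by apply: unb; exists c => _ /fB[x Ax <-]; exact: fc.
Qed.

Lemma small_le T U (A : set T) (B : set U) : A #<= B -> small B -> small A.
Proof. by move=> AB sB bA; apply: sB; exact: card_le_trans AB. Qed.

Lemma small_sub T (A B : set T) : A `<=` B -> small B -> small A.
Proof. by move=> /subset_card_le; exact: small_le. Qed.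

Lemma small_image T U (f : T -> U) (A : set T) : small A -> small (f @` A).
Proof. by apply: small_le; exact: (card_image_le f A). Qed.

Lemma small_card_lt T (A : set T) : small A -> A #< bounding_number.
Proof.
move=> sA; split=> //.
by have [//|bA] := card_le_total A bounding_number; case: (sA bA).
Qed.

(** The bounds found for the pieces form a small family, which is bounded again; this is the
    regularity of b. *)
Lemma small_bigcup I T (A : set I) (F : I -> set T) :
  small A -> (forall i, A i -> small (F i)) -> small (\bigcup_(i in A) F i).
Proof.
move=> /smallP sA sF; apply/smallP => f.
have /choice[c fc] : forall i, exists c, A i ->
    forall x, F i x -> eventually_le (f x) c.
  move=> i; have [Ai|nAi] := pselect (A i); last by exists (cst 0%N).
  by have /smallP/(_ f)[c fc] := sF _ Ai; exists c.
have [d cd] := sA c; exists d => x [i Ai Fix].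
exact: eventually_le_trans (fc _ Ai _ Fix) (cd _ Ai).
Qed.

(** * Scales *)

Section omega1_lt_b.
Hypothesis omega1_lt_b : omega1 #< bounding_number.

Lemma countable_small T (A : set T) : countable A -> small A.
Proof.
move=> cA; have [unc _] := omega1P; apply: small_le omega1_lt_b.2.
apply: (card_le_trans (B := [set: nat])); first exact: cA.
by apply/infiniteP => /finite_set_countable.
Qed.

Lemma small_setU T (A B : set T) : small A -> small B -> small (A `|` B).
Proof.
move=> sA sB; rewrite -bigcup2E; apply: small_bigcup.
  exact: countable_small.
by case=> [|[|n]] _ //=; apply: countable_small.
Qed.


(* An initial segment of length b of a well-order, for E. *)
Lemma nonsmall_chain : exists (E : set (nat -> nat)) (R : rel (nat -> nat)),
  [/\ total R, ~ small E & forall i, E i -> small [set e | E e /\ R e i]].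
Proof.
have [R Rwo] := well_ordering_principle (nat -> nat).
have [anti Rtot] : antisymmetric R /\ total R.
  have woT : wo_chain R predT by apply: withinW.
  split; first by move=> x y; apply: (wo_chain_antisymmetric woT).
  by move=> x y; apply: (wo_chainW woT).
pose I d := [set e | R e d]; pose N := [pred d | `[< ~ small (I d) >]].
have nT : ~ small [set: nat -> nat].
  by move=> sT; apply: sT; exact: card_leT.
(* The chain is the whole order, or the part strictly below the least [m] whose initial segment is
   not small. *)
have [[d Nd]|N0] := pselect (nonempty N); last first.
  exists setT, R; split=> // i _; apply: contrapT => nsi; apply: N0; exists i.
  by apply: asboolT => si; apply: nsi; apply: small_sub si => e [].
have [m [[Nm mmin] _]] := Rwo N (ex_intro _ d Nd).
exists [set e | R e m /\ e <> m], R; split=> // [sE|i [Rim im]].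
  apply: (asboolW Nm).
  apply: (@small_sub _ _ ([set e | R e m /\ e <> m] `|` [set m])).
    by move=> e /= Rem; have [->|] := pselect (e = m); [right|left].
  exact: small_setU sE (countable_small (countable1 _)).
apply: contrapT => nsi; apply: im; apply: anti; rewrite Rim mmin//.
by apply: asboolT => si; apply: nsi; apply: small_sub si => e [].
Qed.

(** A dominating family of size d = b is listed as [h] along a nonsmall chain, and [x i] bounds all
    [h e] with [e] up to [i]. Some [h i0] dominates [g], hence so does [x i] for every [i] beyond
    [i0]. *)
Lemma scale_ex : bounding_number #= dominating_number ->
  exists S, dominating_family S /\
    forall g, small [set s | S s /\ ~ eventually_le g s].
Proof.
move=> bd; have [E [R [Rtot nsE sE]]] := nonsmall_chain.
have [dom _] := dominating_numberP.
have /pcard_surjP[h hE] : dominating_number #<= E.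
  by rewrite -(card_le_eql bd); apply: contrapT.
have /choice[x xP] : forall i, exists c, E i -> forall e, E e -> R e i ->
    eventually_le (h e) c.
  move=> i; have [Ei|nEi] := pselect (E i); last by exists (cst 0%N).
  have /smallP/(_ h)[c hc] := sE _ Ei.
  by exists c => _ e Ee Rei; apply: hc.
have sx g : small [set i | E i /\ ~ eventually_le g (x i)].
  have [_ /hE[i0 Ei0 <-] gi0] := dom g.
  apply: small_sub (sE _ Ei0) => i [Ei ngi]; split=> //.
  have /orP[//|Ri0i] := Rtot i i0; exfalso; apply: ngi.
  by apply: eventually_le_trans gi0 (xP _ Ei _ Ei0 Ri0i).
exists (x @` E); split=> g.
  apply: contrapT => nx; apply: nsE; apply: small_sub (sx g) => i Ei.
  by split=> // gxi; apply: nx; exists (x i) => //; exists i.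
apply: small_sub (@small_image _ _ x _ (sx g)) => _ [[i Ei <-] ngi].
by exists i.
Qed.
End omega1_lt_b.

(** * Cylinders and tail classes in the Cantor space *)

Definition to_set_type T (A : set T) x (Ax : A x) : set_type A :=
  exist _ x (mem_set Ax).

(** Cylinders around [z] converge to [z] coordinatewise, since coordinate [i] is constant on the one
    of length [i.+1]. *)
Lemma open_cylinder (U : set cantor_space) (z : cantor_space) :
  open U -> U z ->
  exists m, forall x : cantor_space, (forall i, (i < m)%N -> x i = z i) -> U x.
Proof.
pose C m := [set x : cantor_space | forall i, (i < m)%N -> x i = z i].
have FC : Filter (filter_from setT C).
  apply: filter_from_filter; first by exists 0%N.
  move=> i j _ _; exists (maxn i j) => // x Cx.
  by split=> k ki; apply: Cx; rewrite leq_max ki ?orbT.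
move=> oU Uz; suff : filter_from setT C --> z.
  by move=> /(_ U (open_nbhs_nbhs (conj oU Uz)))[m _ mU]; exists m.
apply/cvg_sup => i V [_ [[O oO <-] Oz OV]].
by exists i.+1 => // x Cx; apply: OV; rewrite /= /proj Cx.
Qed.

Lemma open_cylinder_sub (Z : set cantor_space) (U : set (set_type Z))
    (z : set_type Z) : open U -> U z ->
  exists m, forall x : set_type Z,
    (forall i, (i < m)%N -> val x i = val z i) -> U x.
Proof.
move=> [V oV <-] /= Vz; have [m mV] := open_cylinder oV Vz.
by exists m => x xz; apply: mV.
Qed.

Definition splice a (x z : nat -> bool) : nat -> bool :=
  fun i => if (i < a)%N then x i else z i.

(** Only the first [a] bits of [x] matter, so [f] takes finitely many values. *)
Lemma splice_bound a (z : nat -> bool) (f : (nat -> bool) -> nat) :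
  exists N, forall x, (f (splice a x z) <= N)%N.
Proof.
exists (\max_(u : a.-tuple bool) f (splice a (nth false u) z)) => x.
have -> : splice a x z = splice a (nth false [tuple x i | i < a]) z.
  apply/funext => i; rewrite /splice; case: ltnP => // ia.
  by rewrite -(tnth_nth _ _ (Ordinal ia)) tnth_mktuple.
exact: (leq_bigmax (F := fun u : a.-tuple bool => f (splice a (nth false u) z))).
Qed.

Definition tail_class (z : nat -> bool) : set (nat -> bool) :=
  [set x | cofinite_set [set n | x n = z n]].

Lemma tail_class_splice a x z : tail_class z (splice a x z).
Proof.
by apply/cofinite_natP; exists a => n /= an; rewrite /splice ltnNge an.
Qed.

Lemma tail_class_sym x z : tail_class z x -> tail_class x z.
Proof.
by move=> /cofinite_natP[N xz]; apply/cofinite_natP; exists N => n /= /xz.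
Qed.

Lemma countable_tail_class z : countable (tail_class z).
Proof.
apply: (@sub_countable _ _ _
  ((fun u : seq bool => splice (size u) (nth false u) z) @` setT)).
  apply: subset_card_le => x /cofinite_natP[N xz]; exists (mkseq x N) => //.
  apply/funext => i; rewrite /splice size_mkseq; case: ltnP => [iN|/xz//].
  by rewrite nth_mkseq.
apply: sub_countable (card_image_le _ _) _; exact: countableP.
Qed.

(** * Blends along fast growing intervals *)

(** Each block reaches beyond the value of [s] at its start. It has length at least two, so it
    contains an even position. *)
Fixpoint knot (s : nat -> nat) k :=
  if k is k'.+1 then (knot s k' + s (knot s k')).+2 else 0%N.

Lemma knotS s k : knot s k.+1 = (knot s k + s (knot s k)).+2.
Proof. by []. Qed.

Lemma knot_ge s k : (k <= knot s k)%N.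
Proof. by elim: k => //= k IH; lia. Qed.

Lemma knot_homo s : {homo knot s : j k / (j <= k)%N}.
Proof. by apply: homo_leq => //= [j k l|k]; [exact: leq_trans|lia]. Qed.

Lemma knot_unbounded s i : exists k, (i < knot s k.+1)%N.
Proof. by exists i; exact: knot_ge. Qed.

Definition block s i := ex_minn (knot_unbounded s i).

Lemma blockE s k i : (knot s k <= i < knot s k.+1)%N -> block s i = k.
Proof.
move=> /andP[ki ik]; rewrite /block; case: ex_minnP => j ij /(_ _ ik).
rewrite leq_eqVlt => /orP[/eqP//|jk].
by have := knot_homo s jk; lia.
Qed.

Lemma block_bounds s i : (knot s (block s i) <= i < knot s (block s i).+1)%N.
Proof.
rewrite /block; case: ex_minnP => -[|k] ij jmin; first by rewrite ij.
by rewrite ij andbT leqNgt; apply/negP => /jmin; rewrite ltnn.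
Qed.

Definition blend s (t : nat -> bool) : nat -> bool :=
  fun i => if odd (block s i) then false else t i.

(** Arbitrarily late odd blocks contain an even position, where [t] is true and the blend is
    false. *)
Lemma blend_not_tail_class s (t : nat -> bool) :
  (forall i, ~~ odd i -> t i) -> ~ tail_class t (blend s t).
Proof.
move=> teven /cofinite_natP[N st]; pose k := N.*2.+1; pose a := knot s k.
have aN : (N <= a)%N by have := knot_ge s k; rewrite /a /k; lia.
have ka i : (a <= i <= a.+1)%N -> blend s t i = false.
  move=> ai; rewrite /blend (@blockE s k); last by rewrite knotS -/a; lia.
  by rewrite /k /= odd_double.
have [oa|ea] := boolP (odd a).
  have := st _ (leqW aN); rewrite /= ka; last lia.
  by rewrite teven //= negbK.
have := st _ aN; rewrite /= ka; last lia.
by rewrite teven.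
Qed.

(** A late even block copies [t] from its start [n] to beyond [s n], hence up to [c n]. *)
Lemma blend_agrees c s t : eventually_le c s ->
  forall N, exists2 n, (N <= n)%N &
    forall k, (n <= k < c n)%N -> blend s t k = t k.
Proof.
move=> /cofinite_natP[M cs] N; have ge := knot_ge s (maxn N M).*2.
have NM : (maxn N M <= knot s (maxn N M).*2)%N by lia.
move: NM; rewrite geq_max => /andP[Nj /cs /= cj].
exists (knot s (maxn N M).*2) => // k /andP[jk kc].
rewrite /blend (@blockE s (maxn N M).*2) ?odd_double// jk knotS.
by apply: leq_trans kc _; apply: leq_trans cj _; lia.
Qed.

(** A blend is compared with the sequence that keeps one of its patterns forever; the bound [c] has
    to be the same for all [s]. *)
Lemma blend_bounded t (Z : set (nat -> bool)) (h : (nat -> bool) -> nat -> nat) :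
  tail_class t `<=` Z -> tail_class (fun=> false) `<=` Z ->
  (forall n y z, Z y -> Z z -> (forall i, (i < h z n)%N -> y i = z i) ->
    (h y n <= h z n)%N) ->
  exists g c, forall s, eventually_le g s -> Z (blend s t) ->
    eventually_le (h (blend s t)) c.
Proof.
move=> tZ fZ hZ.
(* Finitely many words of length [a], continued by 0 or by [t], give the bound [g (n, a)]. *)
have /choice[g gP] : forall na : nat * nat, exists N, forall x b,
    (h (splice na.2 x (if b then fun=> false else t)) na.1 <= N)%N.
  move=> [n a] /=; have [N1 N1P] := splice_bound a t (h^~ n).
  have [N2 N2P] := splice_bound a (fun=> false) (h^~ n).
  exists (maxn N1 N2) => x [|]; first exact: leq_trans (N2P x) (leq_maxr _ _).
  exact: leq_trans (N1P x) (leq_maxl _ _).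
pose G a := \max_(n < a.+1) g (val n, a).
pose c n := maxn (g (n, n)) (\max_(a < (g (n, n)).+1) g (n, val a)).
exists G, c => s /cofinite_natP[N Gs] Zs; apply/cofinite_natP; exists N => n Nn.
have within_block k a : (knot s k <= a)%N -> (g (n, a) <= knot s k.+1)%N ->
    (h (blend s t) n <= g (n, a))%N.
  move=> ka ak; have := gP (n, a) (blend s t) (odd k) => /= gna.
  apply: leq_trans gna; apply: hZ => //.
    by case: (odd k); [apply: fZ|apply: tZ]; exact: tail_class_splice.
  move=> i /leq_trans/(_ (gP (n, a) _ _)) /= ig.
  rewrite /splice; case: ltnP => // ai.
  rewrite /blend (@blockE s k); first by case: (odd k).
  by rewrite (leq_trans ka ai) (leq_trans ig).
have /andP[kn nk] := block_bounds s n; set k := block s n in kn nk.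
(* Either the block of [n] lasts up to [g (n, n)], or the next block starts at some [a] below
   [g (n, n)] and lasts up to [g (n, a)], because [s a] is at least [G a]. The two parts of [c n]
   cover these cases. *)
have [gk|kg] := leqP (g (n, n)) (knot s k.+1).
  exact: leq_trans (within_block _ _ kn gk) (leq_maxl _ _).
apply: (@leq_trans (g (n, knot s k.+1))).
  apply: (within_block k.+1) => //.
  have nG : (g (n, knot s k.+1) <= G (knot s k.+1))%N.
    exact: (leq_bigmax (F := fun i : 'I_(knot s k.+1).+1 =>
      g (val i, knot s k.+1)) (Ordinal (leqW nk))).
  have := Gs (knot s k.+1) (leq_trans Nn (ltnW nk)).
  by rewrite [knot s k.+2]knotS; move: nG => /=; lia.
rewrite leq_max; apply/orP; right.
exact: (leq_bigmax (F := fun i : 'I_(g (n, n)).+1 => g (n, val i))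
  (Ordinal (leqW kg))).
Qed.

(** [g a] bounds the cylinder lengths needed at words of length [a] followed by 0. A late odd block
    starting at [a] is 0 up to [g a], which puts the blend into such a cylinder. *)
Lemma blend_in_open (Z : set cantor_space) (U : set (set_type Z)) :
  open U -> (forall z, tail_class (fun=> false) (val z) -> U z) ->
  tail_class (fun=> false) `<=` Z ->
  exists g, forall s t (y : set_type Z), eventually_le g s ->
    val y = blend s t -> U y.
Proof.
move=> oU QU QZ.
have /choice[m mP] : forall z : nat -> bool, exists m,
    tail_class (fun=> false) z -> forall x : set_type Z,
    (forall i, (i < m)%N -> val x i = z i) -> U x.
  move=> z; have [Qz|nQz] := pselect (tail_class (fun=> false) z); last first.
    by exists 0%N.
  pose w : set_type Z := to_set_type (QZ _ Qz).
  have [m mP] := open_cylinder_sub oU (QU w Qz).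
  by exists m.
have /choice[g gP] := fun a => splice_bound a (fun=> false) m.
exists g => s t y /cofinite_natP[N gs] ys.
pose k := N.*2.+1; pose a := knot s k.
have aN : (N <= a)%N by have := knot_ge s k; rewrite /a /k; lia.
apply: (mP (splice a (blend s t) (fun=> false))).
  exact: tail_class_splice.
move=> i /leq_trans/(_ (gP a _)) ig; rewrite ys /splice; case: ltnP => // ai.
rewrite /blend (@blockE s k); first by rewrite /k /= odd_double.
by have := gs _ aN; rewrite knotS -/a /=; lia.
Qed.

(** * Criteria for and against the Hurewicz property *)

(* [h z n] plays the role of the length of the shortest prefix of [z] whose
   cylinder lies in a member of the n-th cover. *)
Lemma Hurewicz_bounded (Z : set cantor_space) :
  (forall h : cantor_space -> nat -> nat,
    (forall n y z, Z y -> Z z -> (forall i, (i < h z n)%N -> y i = z i) ->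
      (h y n <= h z n)%N) ->
    exists c, forall z, Z z -> eventually_le (h z) c) ->
  Hurewicz (set_type Z).
Proof.
move=> Zbnd U Ucov.
pose P (z : cantor_space) n m V := U n V /\ forall x : set_type Z,
  (forall i, (i < m)%N -> val x i = z i) -> V x.
have Pagree y z n m V : (forall i, (i < m)%N -> y i = z i) ->
    P z n m V -> P y n m V.
  by move=> yz [UV zV]; split=> // x xy; apply: zV => i im; rewrite xy// yz.
have /choice[h hP] : forall z, exists h : nat -> nat, Z z -> forall n,
    (exists V, P z n (h n) V) /\ forall m V, P z n m V -> (h n <= m)%N.
  move=> z; have [Zz|nZz] := pselect (Z z); last by exists (cst 0%N).
  pose w : set_type Z := to_set_type Zz.
  suff /choice[h hP] : forall n, exists m, (exists V, P z n m V) /\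
      forall m' V, P z n m' V -> (m <= m')%N by exists h.
  move=> n; have [Uopen Ucover] := Ucov n.
  have [V UV Vw] : (\bigcup_(V in U n) V) w by rewrite Ucover.
  have [m mV] := open_cylinder_sub (Uopen _ UV) Vw.
  have ex : exists m, `[< exists V, P z n m V >].
    by exists m; apply: asboolT; exists V.
  case: (ex_minnP ex) => k /asboolP kP kmin; exists k; split=> // m' V' PV'.
  by apply: kmin; apply: asboolT; exists V'.
have [n y z Zy Zz yz|c hc] := Zbnd h.
  have [[V PV] _] := hP _ Zz n; have [_] := hP _ Zy n.
  by apply; apply: Pagree PV.
have /choice[V VP] : forall nz : nat * cantor_space, exists V,
    (exists V, P nz.2 nz.1 (c nz.1) V) -> P nz.2 nz.1 (c nz.1) V.
  move=> [n z] /=; have [[V PV]|nV] := pselect (exists V, P z n (c n) V).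
    by exists V.
  by exists set0.
pose word n (u : (c n).-tuple bool) : cantor_space := nth false u.
(* One cover member is used for each word of length [c n] that admits one, so finitely many in all;
   [y] is covered through its own prefix as soon as [h y n <= c n]. *)
exists (fun n => (fun u => V (n, word n u)) @`
  [set u | exists V, P (word n u) n (c n) V]); split=> [n|y].
  split; last by apply: finite_image; exact: finite_finset.
  by move=> _ [u Pu <-]; exact: (VP (n, word n u) Pu).1.
have Zy : Z (val y) by exact: set_valP.
have /cofinite_natP[N hyc] := hc _ Zy; apply/cofinite_natP; exists N => n Nn.
have [[W [UW WP]] _] := hP _ Zy n.
pose u : (c n).-tuple bool := [tuple val y i | i < c n].
have uy i : (i < c n)%N -> word n u i = val y i.
  by move=> ic; rewrite /word -(tnth_nth _ _ (Ordinal ic)) tnth_mktuple.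
have Pu : exists V, P (word n u) n (c n) V.
  exists W; apply: (@Pagree _ (val y)) => //; split=> // x xy.
  by apply: WP => i ih; apply: xy; apply: leq_trans ih (hyc _ Nn).
exists (V (n, word n u)); first by exists u.
by have [_] := VP (n, word n u) Pu; apply => i /uy <-.
Qed.

(** For fixed [n], the open sets [O n m] increase with [m] and cover [W]. Finite selections thus
    amount to a function [c], and the point supplied for [c] is missed infinitely often. *)
Lemma not_Hurewicz_tail (W : topologicalType) (v : W -> cantor_space) t :
  continuous v -> (forall w, ~ tail_class t (v w)) ->
  (forall c, exists w, forall N, exists2 n, (N <= n)%N &
    forall k, (n <= k < c n)%N -> v w k = t k) ->
  ~ Hurewicz W.
Proof.
move=> vcont vt vc HW.
pose O n m := [set w | exists2 k, (n <= k < m)%N & v w k != t k].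
have subO n m m' : (m <= m')%N -> O n m `<=` O n m'.
  move=> mm' w [k /andP[nk km] vk]; exists k => //.
  by rewrite nk (leq_trans km mm').
have openO n m : open (O n m).
  have -> : O n m = \bigcup_(k in [set k | (n <= k < m)%N])
      ((fun w => v w k) @^-1` [set b | b != t k]).
    by apply/seteqP; split=> w [k ? ?]; exists k.
  apply: bigcup_open => k _.
  apply: open_comp; last exact: discrete_open.
  move=> w _; apply: (@continuous_comp _ _ _ v (proj k)); first exact: vcont.
  exact: proj_continuous.
have [n|F [FO Fcov]] := HW (fun n => range (O n)).
  split=> [_ [m _ <-]//|]; apply/seteqP; split=> // w _.
  apply: contrapT => nw; apply: (vt w); apply/cofinite_natP.
  exists n => k nk /=; apply: contrapT => /eqP vk; apply: nw.
  by exists (O n k.+1); [exists k.+1|exists k => //; rewrite nk ltnSn].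
have /choice[c cP] : forall n, exists c, \bigcup_(V in F n) V `<=` O n c.
  move=> n; have [FOn Ffin] := FO n.
  have /choice[d dP] : forall V, exists d, F n V -> V = O n d.
    move=> V; have [FV|nFV] := pselect (F n V); last by exists 0%N.
    by have [d _ <-] := FOn _ FV; exists d.
  have /finite_seqP[s sF] : finite_set (d @` F n) by exact: finite_image.
  exists (\max_(i <- s) i) => w [V FV]; rewrite (dP V FV).
  apply: subO; have : [set` s] (d V) by rewrite -sF; exists V.
  by move=> /(@leq_bigmax_seq _ _ xpredT id)-/(_ erefl).
have [w wP] := vc c; have /cofinite_natP[N NP] := Fcov w.
have [n Nn nP] := wP N; have [k nkc] := cP _ _ (NP _ Nn).
by rewrite nP// eqxx.
Qed.

(** * The space of tail classes and blends *)

(** True values at even positions keep blends with [t] out of the tail class of [t]. *)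
Lemma uncountable_even_true :
  exists T : set (nat -> bool), [/\ ~ countable T, T #<= omega1 &
    forall t, T t -> forall i, ~~ odd i -> t i].
Proof.
(* Odd positions code the graph of w. *)
pose code (w : nat -> nat) i :=
  if odd i then oapp (fun nm => w nm.1 == nm.2) false (unpickle i./2)
  else true.
have code_inj : injective code.
  move=> w w' ww'; apply/funext => n.
  have := congr1 (fun f => f (pickle (n, w n)).*2.+1) ww'.
  by rewrite /code /= odd_double /= uphalf_double pickleK /= eqxx => /esym/eqP.
exists (code @` omega1); split=> [cT||_ [w _ <-] i ni]; last first.
- by rewrite /code (negbTE ni).
- exact: card_image_le.
case: omega1P => + _; apply; apply: sub_countable cT.
have : code @` omega1 #= omega1.
  by apply: inj_card_eq => x y _ _; exact: code_inj.
by rewrite card_eq_le => /andP[].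
Qed.

(** A small set would be Hurewicz by [Hurewicz_bounded], but these blends meet the obstruction of
    [not_Hurewicz_tail]. *)
Lemma blends_not_small (S : set (nat -> nat)) (t : nat -> bool) :
  dominating_family S -> (forall i, ~~ odd i -> t i) ->
  ~ small ((fun s => blend s t) @` S).
Proof.
move=> Sdom teven sX; set X := (fun s => blend s t) @` S : set cantor_space.
apply: (@not_Hurewicz_tail (set_type X) val t).
- exact: initial_continuous.
- move=> w; have [s _ <-] : X (val w) by exact: set_valP.
  exact: blend_not_tail_class.
- move=> c; have [s Ss cs] := Sdom c.
  have Xs : X (blend s t) by exists s.
  pose w : set_type X := to_set_type Xs.
  by exists w; exact: blend_agrees.
- by apply: Hurewicz_bounded => h _; have /smallP := sX; apply.
Qed.

Theorem proposition4p10
  (omega1_lt_b : omega1 #< bounding_number)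
  (b_eq_d : bounding_number #= dominating_number) :
  exists Y : topologicalType,
    [/\ set_of_reals Y, concentrated bounding_number Y, Hurewicz Y &
     forall D : set Y, countable D -> concentrated_on bounding_number D ->
     forall D' : set Y, countable D' -> D `<=` D' ->
     exists A : set Y,
       [/\ countable A, A `<=` [set: Y] `\` D' &
        ~ Hurewicz (set_type ([set: Y] `\` A))]].
Proof.
have [S [Sdom Ssmall]] := scale_ex omega1_lt_b b_eq_d.
have [T [Tunc Tw Teven]] := uncountable_even_true.
have Tsmall : small T by apply: small_le Tw omega1_lt_b.2.
have [t0 Tt0] : T !=set0.
  by apply/set0P/eqP => T0; apply: Tunc; rewrite T0; exact: countable0.
pose Q0 := tail_class (fun=> false).
pose Z : set cantor_space := Q0 `|` \bigcup_(t in T)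
  (tail_class t `|` (fun s => blend s t) @` S).
have QZ : Q0 `<=` Z by move=> z; left.
have TZ t : T t -> tail_class t `<=` Z.
  by move=> Tt z tz; right; exists t => //; left.
have XZ t s : T t -> S s -> Z (blend s t).
  by move=> Tt Ss; right; exists t => //; right; exists s.
(* [late g] gathers the blends for which [s] grows as fast as [g t] requires; outside it and [Q0],
   fewer than b points of [Z] remain. *)
pose late (g : (nat -> bool) -> nat -> nat) := \bigcup_(t in T)
  (fun s => blend s t) @` [set s | S s /\ eventually_le (g t) s].
have small_late g : small (Z `\` (Q0 `|` late g)).
  apply: (@small_sub _ _ (\bigcup_(t in T) (tail_class t `|`
      (fun s => blend s t) @` [set s | S s /\ ~ eventually_le (g t) s]))).
    move=> z [[Qz|[t Tt [tz|[s Ss sz]]]] nz].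
    - by case: nz; left.
    - by exists t => //; left.
    - exists t => //; right; exists s => //; split=> // gs.
      by apply: nz; right; exists t => //; exists s.
  apply: small_bigcup => // t Tt; apply: small_setU => //.
    exact/countable_small/countable_tail_class.
  exact: small_image.
have val_card (C : set (set_type Z)) : val @` C #= C.
  by apply: inj_card_eq => x y _ _; exact: val_inj.
have tail_countable t : countable [set y : set_type Z | tail_class t (val y)].
  apply: sub_countable (countable_tail_class t).
  rewrite -(card_le_eql (val_card _)).
  by apply: subset_card_le => _ [y ty <-].
have bZ : bounding_number #<= [set: set_type Z].
  have := contrapT (blends_not_small Sdom (Teven _ Tt0)).
  move=> /card_le_trans; apply.
  rewrite -(card_le_eqr (val_card _)); apply: subset_card_le => _ [s Ss <-].
  pose y : set_type Z := to_set_type (XZ _ _ Tt0 Ss).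
  by exists y.
exists (set_type Z); split.
- split; last by exists Z; exists id, id; split=> // x; exact: cvg_id.
  by move=> /finite_set_countable/(countable_small omega1_lt_b); apply.
- exists [set y | Q0 (val y)]; split; first exact: tail_countable.
  split=> // U oU QU; apply: small_card_lt.
  have [g gP] := blend_in_open oU QU QZ.
  apply: (small_le _ (small_late (fun=> g))).
  rewrite -(card_le_eql (val_card _)).
  apply: subset_card_le => _ [y [_ nUy] <-]; split; first exact: set_valP.
  move=> [Qy|[t Tt [s [Ss gs] sy]]]; apply: nUy; first exact: QU.
  exact: gP gs (esym sy).
- apply: Hurewicz_bounded => h hZ.
  have /choice[gc gcP] : forall t, exists gc : (nat -> nat) * (nat -> nat),
      T t -> forall s, eventually_le gc.1 s -> Z (blend s t) ->
      eventually_le (h (blend s t)) gc.2.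
    move=> t; have [Tt|nTt] := pselect (T t); last first.
      by exists (cst 0%N, cst 0%N).
    by have [g [c gc]] := blend_bounded (TZ _ Tt) QZ hZ; exists (g, c).
  have sQ0 : small Q0 by exact/countable_small/countable_tail_class.
  (* [c0] serves [Q0] and the small remainder; [c1] bounds the functions found for all [t] in the
     small set [T] and serves the late blends. *)
  have /smallP/(_ h)[c0 c0P] := small_setU omega1_lt_b sQ0
    (small_late (fun t => (gc t).1)).
  have [c1 c1P] := iffLR (smallP T) Tsmall (fun t => (gc t).2).
  have le_max a (b b' : nat -> nat) : eventually_le a b \/ eventually_le a b' ->
      eventually_le a (fun n => maxn (b n) (b' n)).
    by case=> /cofinite_natP[N ab]; apply/cofinite_natP; exists N => n /ab /=;
      rewrite leq_max => ->; rewrite ?orbT.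
  exists (fun n => maxn (c0 n) (c1 n)) => z Zz; apply: le_max.
  have [[Qz|[t Tt [s [Ss gs] sz]]]|nz] :=
      pselect ((Q0 `|` late (fun t => (gc t).1)) z).
  + by left; apply: c0P; left.
  + right; apply: eventually_le_trans (c1P _ Tt).
    by rewrite -sz; apply: gcP => //; rewrite sz.
  + by left; apply: c0P; right.
- move=> D _ _ D' cD' _.
  have [t Tt tD'] : exists2 t, T t & forall y, D' y -> ~ tail_class t (val y).
    (* Otherwise [T] lies in a union of countably many countable tail classes. *)
    apply: contrapT => nt; apply: Tunc.
    apply: (@sub_countable _ _ _ (\bigcup_(y in D') tail_class (val y))).
      apply: subset_card_le => t Tt; apply: contrapT => ntD; apply: nt.
      exists t => // y D'y ty; apply: ntD; exists y => //.
      exact: tail_class_sym.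
    by apply: bigcup_countable => // y _; exact: countable_tail_class.
  exists [set y | tail_class t (val y)]; split.
  + exact: tail_countable.
  + by move=> y ty; split=> // /tD'.
  pose W := [set: set_type Z] `\` [set y | tail_class t (val y)].
  apply: (@not_Hurewicz_tail (set_type W) (fun w => val (val w)) t).
  + move=> w; apply: continuous_comp; exact: initial_continuous.
  + by move=> w; have [] := set_valP w.
  move=> c; have [s Ss cs] := Sdom c.
  pose y : set_type Z := to_set_type (XZ _ _ Tt Ss).
  have Wy : W y.
    by split=> //; apply: blend_not_tail_class; exact: Teven.
  by exists (to_set_type Wy); exact: blend_agrees.
Qed.
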